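(* Let $\{\varphi_t\}_{t\ge 0}$ be a semigroup of analytic functions on the unit disk $\mathbb{D}$ and, for $t\ge 0$, let $T_tf=\varphi_t'\,(f\circ\varphi_t)$ be the induced semigroup of bounded operators on a Banach space $X$ of analytic functions on $\mathbb{D}$. Suppose that: (1) polynomials are dense in $X$; (2) there is a constant $C$ such that whenever $f,g\in X$ satisfy $|f|\le |g|$ in $\mathbb{D}$, then $\|f\|_X\le C\|g\|_X$; (3) $\sup_{0\le t\le 1}\|T_t\|<\infty$; (4) $\|\varphi_t-\mathrm{id}\|_X\to 0$ and $\|\varphi_t'-1\|_X\to 0$ as $t\to 0^+$. Then $\{T_t\}$ is strongly continuous on $X$, that is, $\lim_{t\to 0^+}\|T_tf-f\|_X=0$ for every $f\in X$.
   Context: A (one-parameter) semigroup of analytic functions is a family $\{\varphi_t:t\ge 0\}$ of analytic self-maps of the unit disk $\mathbb{D}$ such that $\varphi_0$ is the identity, $\varphi_{t+s}=\varphi_t\circ\varphi_s$ for all $t,s\ge0$, and $\varphi_t\to\varphi_0$ uniformly on compact subsets of $\mathbb{D}$ as $t\to 0$. The prime denotes the derivative in $z$: $\varphi_t'(z)=\frac{\partial\varphi_t}{\partial z}(z)$. Here $\mathrm{id}(z)=z$. The induced operators $T_t$ are assumed to be bounded on $X$ for every $t\geq 0$. *)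

(* Defs.v *)
From HB Require Import structures.
From mathcomp Require Import all_boot all_order all_algebra.
From mathcomp Require Import all_classical all_reals all_analysis.
From mathcomp Require Import complex.
Set Implicit Arguments.
Unset Strict Implicit.
Unset Printing Implicit Defensive.
Import Order.TTheory GRing.Theory Num.Theory numFieldNormedType.Exports.
Local Open Scope classical_set_scope.
Local Open Scope ring_scope.

(* R[i] packed as a [numFieldType], so that its topology and its structure of
   normed space over itself are the generic ones of numeric fields. *)
Definition C (R : realType) : numFieldType := R[i]%C.

Section Defs.
Variable R : realType.
Implicit Type X : normedModType (C R).

Definition disk : set (C R) := [set z | `|z| < 1].

(* The norms of C R and of C R-modules are C R-valued: this is the same norm
   as a real number. *)
Definition rnorm X (x : X) : R := complex.Re `|x|.

Definition analytic_on (D : set (C R)) (f : C R -> C R) :=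
  forall z, D z -> derivable f z 1.

(* Only the restrictions of the phi t to the disk, for t >= 0, are meaningful;
   the values elsewhere are unconstrained. *)
Record analytic_semigroup (phi : R -> C R -> C R) : Prop := AnalyticSemigroup {
  semigroup_analytic : forall t, 0 <= t -> analytic_on disk (phi t) ;
  semigroup_self : forall t, 0 <= t -> forall z, disk z -> disk (phi t z) ;
  semigroup_0 : forall z, disk z -> phi 0 z = z ;
  semigroup_D : forall t s, 0 <= t -> 0 <= s ->
    forall z, disk z -> phi (t + s) z = phi t (phi s z) ;
  semigroup_cvg : forall K : set (C R), compact K -> K `<=` disk ->
    {uniform K, phi t @[t --> within [set t | 0 <= t] (nbhs (0 : R))]
                --> phi 0}
}.

(* [ev] reads the elements of X as functions, [ev f] being considered on the
   disk only. As usual for a Banach space of analytic functions, norm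
   convergence implies pointwise convergence (equivalently, by the uniform
   boundedness principle, locally uniform convergence). *)
Record analytic_function_space X (ev : X -> C R -> C R) : Prop :=
  AnalyticFunctionSpace {
  ev_linear : forall z, disk z -> forall (a : C R) (f g : X),
    ev (a *: f + g) z = a * ev f z + ev g z ;
  ev_analytic : forall f, analytic_on disk (ev f) ;
  ev_inj : forall f g, (forall z, disk z -> ev f z = ev g z) -> f = g ;
  ev_continuous : forall z, disk z -> continuous (fun f => ev f z)
}.

Section Space.
Variables (X : normedModType (C R)) (ev : X -> C R -> C R).

(* [represents f h]: the restriction of h to the disk is the element f of X. *)
Definition represents (f : X) (h : C R -> C R) :=
  forall z, disk z -> ev f z = h z.

(* [h t] is an element of X for small t > 0 and tends to 0 in X. *)
Definition vanishes_in (h : R -> C R -> C R) :=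
  exists2 u : R -> X, (\forall t \near 0^'+, represents (u t) (h t)) &
    rnorm (u t) @[t --> 0^'+] --> (0 : R).

Definition polynomials_dense :=
  (forall p : {poly C R}, exists f, represents f (horner p)) /\
  dense [set f | exists p : {poly C R}, represents f (horner p)].

Definition lattice_norm := exists c : R, forall f g : X,
  (forall z, disk z -> `|ev f z| <= `|ev g z|) -> rnorm f <= c * rnorm g.

End Space.

Definition opnorm X (A : X -> X) : \bar R :=
  ereal_sup [set (rnorm (A f))%:E | f in [set f | rnorm f <= 1]].

End Defs.

(* Main.v *)
(* A function [h] bounded by 1 on the disk that multiplies polynomials into X
   multiplies all of X into X: by the lattice condition [q |-> h q] is Lipschitz
   on the dense set of polynomials, so it extends by completeness. Applied first
   to [h = z], then to [h = phi t], this puts [p \o phi t] and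
   [(phi t)' * (p \o phi t)] in X for every polynomial p, so that in X
     T t p - p = ((phi t)' - 1) * (p \o phi t) + (p \o phi t - p),
   and the lattice condition bounds the two terms by multiples of
   [(phi t)' - 1] and of [phi t - id]. Density of the polynomials and the
   uniform bound on the T t conclude. *)
Require Import Defs.
From mathcomp Require Import all_boot all_order all_algebra.
From mathcomp Require Import all_classical all_reals all_analysis.
From mathcomp Require Import complex.
From mathcomp Require Import ring lra.
Set Implicit Arguments.
Unset Strict Implicit.
Unset Printing Implicit Defensive.
Import Order.TTheory GRing.Theory Num.Theory numFieldNormedType.Exports.
Local Open Scope classical_set_scope.
Local Open Scope ring_scope.

(** * The complex-valued norm handled as a real number *)

Section RealNorm.
Context {R : realType} {X : normedModType (C R)}.
Implicit Types x y : X.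

Lemma normrE_rnorm x : `|x| = (rnorm x)%:C%C :> C R.
Proof. by rewrite /rnorm RRe_real// normr_real. Qed.

Lemma rnorm_ge0 x : 0 <= rnorm x.
Proof. by rewrite -lecR -normrE_rnorm; exact: normr_ge0. Qed.

Lemma rnormD x y : rnorm (x + y) <= rnorm x + rnorm y.
Proof. by rewrite -lecR raddfD/= -!normrE_rnorm; exact: ler_normD. Qed.

Lemma rnormB x y : rnorm (x - y) = rnorm (y - x).
Proof. by rewrite /rnorm distrC. Qed.

Lemma rnormZ (a : C R) x : rnorm (a *: x) = complex.Re `|a| * rnorm x.
Proof.
rewrite /rnorm normrZ normrE_rnorm.
have -> : `|a| = (complex.Re `|a|)%:C%C :> C R by rewrite RRe_real// normr_real.
by rewrite -rmorphM.
Qed.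

Lemma rnorm_lt x (e : C R) : 0 < e -> (`|x| < e) = (rnorm x < complex.Re e).
Proof.
by move=> e0; rewrite normrE_rnorm -{1}(RRe_real (gtr0_real e0)) ltcR.
Qed.

Lemma Re_gt0 (e : C R) : 0 < e -> 0 < complex.Re e.
Proof. by move=> e0; rewrite -ltcR RRe_real// gtr0_real. Qed.

Lemma rnorm_eq0 x : rnorm x = 0 -> x = 0.
Proof. by move=> x0; apply/eqP; rewrite -normr_eq0 normrE_rnorm x0. Qed.

Lemma rnorm0 : rnorm (0 : X) = 0.
Proof. by rewrite /rnorm normr0. Qed.

Lemma dense_rnorm (S : set X) (f : X) (e : R) : dense S -> 0 < e ->
  exists2 g, S g & rnorm (g - f) < e.
Proof.
move=> dS e0.
have e0C : 0 < e%:C%C :> C R by rewrite ltcR.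
have [||g []] := dS (ball f (e%:C%C : C R)).
- by exists f; exact: ballxx.
- exact: ball_open.
- rewrite -ball_normE/= => fg Sg; exists g => //.
  by move: fg; rewrite rnorm_lt// rnormB.
Qed.

End RealNorm.

(** By homogeneity, [f] can be rescaled to norm 1, where the supremum defining [opnorm] applies; for
    [f] of norm 0, homogeneity gives [A 0 = 0]. *)
Lemma opnorm_le (R : realType) (X : normedModType (C R)) (A : X -> X) (K : R) :
  (forall (a : C R) f, A (a *: f) = a *: A f) ->
  (opnorm A <= K%:E)%E -> forall f, rnorm (A f) <= K * rnorm f.
Proof.
move=> AZ AK f.
have [/rnorm_eq0 ->|f0] := eqVneq (rnorm f) 0.
  by rewrite -(scale0r (0 : X)) AZ !scale0r rnorm0 mulr0.
have f_gt0 : 0 < rnorm f by rewrite lt_neqAle eq_sym f0 rnorm_ge0.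
have nV : complex.Re `|((rnorm f)^-1)%:C%C : C R| = (rnorm f)^-1.
  by rewrite ger0_norm// lecR invr_ge0 ltW.
have : ((rnorm (A (((rnorm f)^-1)%:C%C *: f)))%:E <= K%:E)%E.
  apply: le_trans AK; apply: ereal_sup_ubound.
  by exists (((rnorm f)^-1)%:C%C *: f); rewrite //= rnormZ nV mulVf.
by rewrite lee_fin AZ rnormZ nV ler_pdivrMl// mulrC.
Qed.

(** * Sequences controlled by the rate 1/(n+1) *)

Section Sequences.
Context {R : realType} {X : normedModType (C R)}.

Lemma cvg_rnorm_harmonic (u : nat -> X) (f : X) :
  (forall n, rnorm (u n - f) < n.+1%:R^-1) -> u n @[n --> \oo] --> f.
Proof.
move=> uf; apply/cvgrPdist_lt => e e0; near=> n.
rewrite rnorm_lt// rnormB (lt_trans (uf n))//; near: n.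
exact: (near_infty_natSinv_lt (PosNum (Re_gt0 e0))).
Unshelve. all: by end_near.
Qed.

Lemma cauchy_rnorm_harmonic (u : nat -> X) (c : R) : 0 <= c ->
  (forall m n, rnorm (u m - u n) <= c * (m.+1%:R^-1 + n.+1%:R^-1)) ->
  cauchy (u n @[n --> \oo]).
Proof.
move=> c0 uc; apply/cauchy_ballP => e e0.
(* With this [d], [c * (d + d)] is c/(c+1) times the real part of [e], hence strictly below it; the
   [+ 1] covers [c = 0]. *)
pose d := complex.Re e / (2 * (c + 1)).
have d0 : 0 < d by rewrite divr_gt0 ?Re_gt0// mulr_gt0// ltr_wpDl.
have [N _ NP] := near_infty_natSinv_lt (PosNum d0).
pose A := u @` [set n | (N <= n)%N].
exists (A, A) => /=; first by split; exists N => // n Nn; exists n.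
move=> [_ _] [[m /= Nm <-] [n /= Nn <-]].
rewrite /= -ball_normE/= rnorm_lt// (le_lt_trans (uc m n))//.
rewrite (@le_lt_trans _ _ (c * (d + d)))//.
  by rewrite ler_wpM2l// lerD// ltW//; exact: NP.
have -> : c * (d + d) = c / (c + 1) * complex.Re e by rewrite /d; field; lra.
rewrite gtr_pMl ?Re_gt0// ltr_pdivrMr; lra.
Qed.

End Sequences.

(** * Sup and Lipschitz bounds of polynomials on the disk *)

Section PolyBounds.
Variable R : realType.
Local Notation disk := (@disk R).

Lemma poly_disk_bounded (p : {poly C R}) :
  exists M : C R, forall z, disk z -> `|p.[z]| <= M.
Proof.
elim/poly_ind: p => [|p c [M pM]].
  by exists 0 => z _; rewrite horner0 normr0.
exists (M + `|c|) => z zD; rewrite hornerMXaddC.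
rewrite (le_trans (ler_normD _ _))// lerD2r normrM -[M]mulr1.
by apply: ler_pM => //; [exact: pM|exact: ltW].
Qed.

Lemma poly_disk_lipschitz (p : {poly C R}) : exists L : C R,
  forall w z, disk w -> disk z -> `|p.[w] - p.[z]| <= L * `|w - z|.
Proof.
elim/poly_ind: p => [|p c [L pL]].
  by exists 0 => w z _ _; rewrite !horner0 subrr normr0 mul0r.
have [M pM] := poly_disk_bounded p.
exists (M + L) => w z wD zD; rewrite !hornerMXaddC.
have -> : p.[w] * w + c - (p.[z] * z + c) =
    p.[w] * (w - z) + (p.[w] - p.[z]) * z by ring.
rewrite (le_trans (ler_normD _ _))// !normrM mulrDl lerD//.
  by rewrite ler_wpM2r// pM.
rewrite -[leRHS]mulr1; apply: ler_pM => //; [exact: pL|exact: ltW].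
Qed.

End PolyBounds.

(** * Pointwise multipliers of the function space *)

Section FunctionSpace.
Variables (R : realType) (X : completeNormedModType (C R)).
Variable ev : X -> C R -> C R.
Hypotheses (X_space : analytic_function_space ev)
  (X_dense : polynomials_dense ev) (X_lattice : lattice_norm ev).
Implicit Types (f g : X) (h k : C R -> C R).
Local Notation disk := (@disk R).

Lemma evD z f g : disk z -> ev (f + g) z = ev f z + ev g z.
Proof.
by move=> zD; have := ev_linear X_space zD 1 f g; rewrite scale1r mul1r.
Qed.

Lemma ev0 z : disk z -> ev 0 z = 0.
Proof.
by move=> zD; apply: (addrI (ev 0 z)); rewrite -evD// !addr0.
Qed.

Lemma evZ z (a : C R) f : disk z -> ev (a *: f) z = a * ev f z.
Proof.
by move=> zD; rewrite -[_ *: _]addr0 (ev_linear X_space)// ev0// addr0.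
Qed.

Lemma evB z f g : disk z -> ev (f - g) z = ev f z - ev g z.
Proof. by move=> zD; rewrite evD// -scaleN1r evZ// mulN1r. Qed.

Lemma lattice_norm_scale : exists2 c : R, 0 <= c & forall (M : C R) f g,
  (forall z, disk z -> `|ev f z| <= M * `|ev g z|) ->
  rnorm f <= c * complex.Re `|M| * rnorm g.
Proof.
have [c cP] := X_lattice; exists `|c| => // M f g fg.
(* The lattice condition is applied to [f] and [M *: g]. Since [M * |ev g z|] dominates a modulus,
   it is real and nonnegative, so it is the modulus of [M *: g] at [z]. *)
rewrite -mulrA -rnormZ (@le_trans _ _ (c * rnorm (M *: g)))//.
  apply: cP => z zD; rewrite evZ// normrM -[`|ev g z|]normr_id -normrM.
  by rewrite ger0_norm ?fg// (le_trans _ (fg z zD)).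
by rewrite ler_wpM2r ?rnorm_ge0 ?ler_norm.
Qed.

Definition multiplier h :=
  forall f, exists g, represents ev g (fun z => h z * ev f z).

Lemma multiplierM h k : multiplier h -> multiplier k ->
  multiplier (fun z => h z * k z).
Proof.
move=> hX kX f; have [g gE] := kX f; have [g' gE'] := hX g.
by exists g' => z zD; rewrite gE'// gE// mulrA.
Qed.

Lemma multiplierD h k : multiplier h -> multiplier k ->
  multiplier (fun z => h z + k z).
Proof.
move=> hX kX f; have [g gE] := kX f; have [g' gE'] := hX f.
by exists (g' + g) => z zD; rewrite evD// gE'// gE// mulrDl.
Qed.

Lemma multiplier_cst (a : C R) : multiplier (fun=> a).
Proof. by move=> f; exists (a *: f) => z zD; rewrite evZ. Qed.

(** Multipliers contain the constants and are closed under sums and products, so Horner's scheme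
    never leaves them. *)
Lemma multiplier_poly h (p : {poly C R}) : multiplier h ->
  multiplier (fun z => p.[h z]).
Proof.
move=> hX; elim/poly_ind: p => [|p c pX] f.
  have [g gE] := multiplier_cst 0 f.
  by exists g => z zD; rewrite gE// horner0.
have [g gE] := multiplierD (multiplierM pX hX) (multiplier_cst c) f.
by exists g => z zD; rewrite gE// hornerMXaddC.
Qed.

Lemma multiplier_bounded h : (forall z, disk z -> `|h z| <= 1) ->
  (forall p : {poly C R}, exists g, represents ev g (fun z => h z * p.[z])) ->
  multiplier h.
Proof.
move=> h_le1 hp f.
have [c c0 cP] := lattice_norm_scale.
have /choice[q qP] : forall n : nat, exists q : X,
    (exists p : {poly C R}, represents ev q (horner p)) /\
    rnorm (q - f) < n.+1%:R^-1.
  move=> n; have [|q qp qf] := dense_rnorm f X_dense.2 (_ : 0 < n.+1%:R^-1).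
    by rewrite invr_gt0.
  by exists q.
have /choice[u uP] : forall n : nat, exists u,
    represents ev u (fun z => h z * ev (q n) z).
  move=> n; have [[p pq] _] := qP n; have [u uE] := hp p.
  by exists u => z zD; rewrite uE// pq.
have u_cauchy : cauchy (u n @[n --> \oo]).
  apply: (cauchy_rnorm_harmonic c0) => m n.
  rewrite (@le_trans _ _ (c * rnorm (q m - q n)))//.
    (* The factor 1 is the bound on [|h|], playing the role of [M] in [cP]. *)
    rewrite -[X in X * _]mulr1.
    have -> : 1 = complex.Re `|1 : C R| by rewrite normr1.
    apply: cP => z zD.
    by rewrite !evB// !uP// -mulrBr normrM ler_wpM2r// h_le1.
  rewrite ler_wpM2l//.
  have -> : q m - q n = (q m - f) + (f - q n) by rewrite addrA subrK.
  rewrite (le_trans (rnormD _ _))// [rnorm (f - _)]rnormB.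
  by apply: lerD; apply: ltW; case: (qP m); case: (qP n).
have q_cvg : q n @[n --> \oo] --> f.
  by apply: cvg_rnorm_harmonic => n; case: (qP n).
have /cauchy_cvgP/cvg_ex[/= g ug] := u_cauchy.
exists g => z zD.
(* The limit [g] is identified pointwise: evaluation at [z] is continuous, so
   [ev (u n) z = h z * ev (q n) z] tends both to [ev g z] and to [h z * ev f z]. *)
have evz_cvg (w : nat -> X) l : w n @[n --> \oo] --> l ->
    ev (w n) z @[n --> \oo] --> ev l z.
  move=> wl; apply: (cvg_comp w (fun f => ev f z) wl).
  exact: (@ev_continuous _ _ _ X_space).
apply: (@cvg_unique _ (@norm_hausdorff _ (C R)) _ _ _ _ (evz_cvg _ _ ug)).
have -> : (fun n => ev (u n) z) = (fun n => h z * ev (q n) z).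
  by apply/funext => n; rewrite uP.
by apply: cvgMl_tmp; exact: evz_cvg.
Qed.

Lemma multiplier_id : multiplier id.
Proof.
apply: multiplier_bounded => [z zD|p]; first exact: ltW.
have [g gE] := X_dense.1 ('X * p).
by exists g => z zD; rewrite gE// hornerM hornerX.
Qed.

(** Polynomials in z are multipliers, so [h] times a polynomial is that polynomial acting on [g], an
    element of [X]. *)
Lemma multiplier_self h g : (forall z, disk z -> disk (h z)) ->
  represents ev g h -> multiplier h.
Proof.
move=> h_self gE; apply: multiplier_bounded => [z zD|p].
  exact/ltW/h_self.
have [f fE] := multiplier_poly p multiplier_id g.
by exists f => z zD; rewrite fE// gE// mulrC.
Qed.

End FunctionSpace.

Theorem theorem7 (R : realType)
  (phi : R -> C R -> C R) (phi_semigroup : analytic_semigroup phi)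
  (X : completeNormedModType (C R)) (ev : X -> C R -> C R)
  (X_space : analytic_function_space ev)
  (T : R -> X -> X)
  (T_def : forall t, 0 <= t -> forall f : X,
     represents ev (T t f) (fun z => derive1 (phi t) z * ev f (phi t z)))
  (T_bounded : forall t, 0 <= t -> (opnorm (T t) < +oo)%E)
  (h1 : polynomials_dense ev)
  (h2 : lattice_norm ev)
  (h3 : (ereal_sup [set opnorm (T t) | t in `[0%R, 1%R]] < +oo)%E)
  (h4 : vanishes_in ev (fun t z => phi t z - z))
  (h4' : vanishes_in ev (fun t z => derive1 (phi t) z - 1)) :
  forall f : X, rnorm (T t f - f) @[t --> 0^'+] --> (0 : R).
Proof.
have phi_self t (t0 : 0 <= t) z : disk z -> disk (phi t z).
  by move=> zD; exact: semigroup_self phi_semigroup _ t0 _ zD.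
have TB t (t0 : 0 <= t) f g : T t (f - g) = T t f - T t g.
  apply: (ev_inj X_space) => z zD.
  by rewrite (evB X_space)// !T_def// (evB X_space) ?mulrBr//; exact: phi_self.
have TZ t (t0 : 0 <= t) a f : T t (a *: f) = a *: T t f.
  apply: (ev_inj X_space) => z zD.
  by rewrite (evZ X_space)// !T_def// (evZ X_space) 1?mulrCA//; exact: phi_self.
have [K K0 T_le] : exists2 K : R, 0 <= K &
    forall t, 0 <= t <= 1 -> forall f, rnorm (T t f) <= K * rnorm f.
  set S := ereal_sup _ in h3.
  (* [h3] excludes [+oo], the only case where [fine S] could fail to bound [S]; the maximum with 0
     makes the constant nonnegative. *)
  exists (Num.max 0 (fine S)); first by rewrite le_max lexx.
  move=> t t01 f; have /andP[t0 t1] := t01.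
  apply: opnorm_le => [a g|]; first exact: TZ.
  have St : (opnorm (T t) <= S)%E.
    by apply: ereal_sup_ubound; exists t => //=; rewrite in_itv/=.
  rewrite (le_trans St)//; case: S h3 {St} => [s _||_] //=.
    by rewrite lee_fin le_max lexx orbT.
  by rewrite leNye.
have [c c0 cP] := lattice_norm_scale X_space h2.
have [u uE u_cvg] := h4.
have [v vE v_cvg] := h4'.
have T_poly p f : represents ev f (horner p) ->
    rnorm (T t f - f) @[t --> 0^'+] --> (0 : R).
  move=> fE.
  have [M MP] := poly_disk_bounded p.
  have [L LP] := poly_disk_lipschitz p.
  have [x xE] := h1.1 'X.
  have [one oneE] := h1.1 1%:P.
  (* [M] bounds [p] on the disk and controls the term with [(phi t)' - 1]; [L] is a Lipschitz
     constant of [p] there and controls [p \o phi t - p]. *)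
  apply: (@squeeze_cvgr _ _ _ _ (cst 0)
    (fun t => c * complex.Re `|M| * rnorm (v t) +
              c * complex.Re `|L| * rnorm (u t))).
  - near=> t.
    rewrite rnorm_ge0 /=.
    have t0 : 0 <= t by near: t; exact: nbhs_right_ge.
    have uEt : represents ev (u t) (fun z => phi t z - z) by near: t.
    have vEt : represents ev (v t) (fun z => derive1 (phi t) z - 1) by near: t.
    (* Adding z back to [phi t - id] shows that [phi t] belongs to [X]; as a self-map of the disk it
       is then a multiplier. *)
    have phiX : represents ev (u t + x) (phi t).
      by move=> z zD; rewrite (evD X_space)// uEt// xE// hornerX subrK.
    have p_phi := multiplier_poly X_space p
      (multiplier_self X_space h1 h2 (phi_self t t0) phiX).
    (* Multiplying [v t] gives the first term of the decomposition; multiplying the constant 1 puts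
       [p \o phi t] itself in [X]. *)
    have [a aE] := p_phi (v t).
    have [b bE] := p_phi one.
    have -> : T t f - f = a + (b - f).
      apply: (ev_inj X_space) => z zD.
      rewrite (evB X_space)// T_def// (evD X_space)// (evB X_space)//.
      rewrite (fE _ zD) (fE _ (phi_self t t0 z zD)).
      by rewrite aE// bE// vEt// oneE// hornerC mulrBr !mulr1 addrA subrK mulrC.
    rewrite (le_trans (rnormD _ _))// lerD//; apply: cP => z zD.
      by rewrite aE// normrM ler_wpM2r//; exact/MP/phi_self.
    rewrite (evB X_space)// bE// oneE// hornerC mulr1 fE// uEt//.
    by apply: LP => //; exact: phi_self.
  - exact: cvg_cst.
  - rewrite -[X in _ --> X]addr0.
    rewrite -[X in _ --> X + _](mulr0 (c * complex.Re `|M|)).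
    rewrite -[X in _ --> _ + X](mulr0 (c * complex.Re `|L|)).
    by apply: cvgD; apply: cvgMl_tmp.
move=> f; apply/cvgr0Pnorm_lt => e e0.
(* The error splits into [T t (f - g)], costing [K] times the distance to [g], and two terms
   [T t g - g] and [g - f] costing one share each: [K + 2] shares of [e / (K + 2)]. *)
have K1 : 0 < K + 2 by lra.
have [|g [p gp] gf] := dense_rnorm f h1.2 (_ : 0 < e / (K + 2)).
  exact: divr_gt0.
have /cvgr0Pnorm_lt := T_poly p g gp; move=> /(_ _ (divr_gt0 e0 K1)) Tg.
near=> t.
have t0 : 0 <= t by near: t; exact: nbhs_right_ge.
have t1 : t <= 1 by near: t; exact: nbhs_right_le.
have Tgt : rnorm (T t g - g) < e / (K + 2).
  by rewrite -[ltLHS]ger0_norm ?rnorm_ge0//; near: t.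
rewrite ger0_norm ?rnorm_ge0//.
have -> : T t f - f = T t (f - g) + ((T t g - g) + (g - f)).
  by rewrite TB// !addrA !subrK.
have T_fg : rnorm (T t (f - g)) <= K * rnorm (g - f).
  by rewrite [rnorm (g - f)]rnormB T_le// t0.
have -> : e = K * (e / (K + 2)) + (e / (K + 2) + e / (K + 2)).
  by field; rewrite gt_eqF.
(* Strictness comes from the last two terms, since [K] may be 0. *)
rewrite (le_lt_trans (rnormD _ _))// ler_ltD//.
  by rewrite (le_trans T_fg)// ler_wpM2l// ltW.
by rewrite (le_lt_trans (rnormD _ _))// ltrD.
Unshelve. all: by end_near.
Qed.
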